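(* Let $\Gamma$ be a connected graph on vertices $\{1,\dots,N\}$ containing all loops $(i,i)$. Then there is an open, everywhere dense subset $\mathbf H_\Gamma^{(+)}\subset\mathbf H_\Gamma$ whose complement $\mathbf H_\Gamma\setminus\mathbf H_\Gamma^{(+)}$ has dimension smaller than $\dim\mathbf H_\Gamma$, such that $\dim L_0(V)=0$ (i.e. $l_V=\mathbb R^N$) for every $V\in\mathbf H_\Gamma^{(+)}$.
   Context: $\mathbf H_\Gamma$ is the set of real symmetric positive-definite $N\times N$ matrices $V$ with $V(i,j)=0$ whenever $(i,j)$ is not an edge of $\Gamma$; it is an open subset of a real vector space whose dimension equals the number of edges of $\Gamma$ (loops included). $l_V$ is the span of $V^ke_1$, $k\ge0$, where $e_1$ is the first standard basis vector (vertex $1$ is the particle in contact with the environment); $L_-(V)=\{(q,p)\in\mathbb R^{2N}:q,p\in l_V\}$ and $L_0(V)$ is its orthogonal complement. *)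

(* Defs.v *)
From Stdlib Require Import Reals Relations.
Open Scope R_scope.

(* Conventions: vertices {1,...,N} are encoded as indices 0..N-1 (vertex 1 = index 0).
   Vectors of R^N are functions nat -> R (only indices < N matter);
   N x N matrices are functions nat -> nat -> R. *)

Fixpoint sumN (n : nat) (f : nat -> R) : R :=
  match n with O => 0 | S m => sumN m f + f m end.

Definition dot (N : nat) (x y : nat -> R) : R := sumN N (fun i => x i * y i).

Definition matvec (N : nat) (V : nat -> nat -> R) (x : nat -> R) : nat -> R :=
  fun i => sumN N (fun j => V i j * x j).

Definition e1 : nat -> R := fun i => if Nat.eqb i 0 then 1 else 0.

Fixpoint krylov (N : nat) (V : nat -> nat -> R) (k : nat) : nat -> R :=
  match k with
  | O => e1
  | S k' => matvec N V (krylov N V k')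
  end.

Definition in_lV (N : nat) (V : nat -> nat -> R) (x : nat -> R) : Prop :=
  exists (n : nat) (c : nat -> R),
    forall i, (i < N)%nat -> x i = sumN n (fun k => c k * krylov N V k i).

Definition in_Lminus (N : nat) (V : nat -> nat -> R) (q p : nat -> R) : Prop :=
  in_lV N V q /\ in_lV N V p.

Definition in_L0 (N : nat) (V : nat -> nat -> R) (q p : nat -> R) : Prop :=
  forall a b, in_Lminus N V a b -> dot N q a + dot N p b = 0.

Definition L0_trivial (N : nat) (V : nat -> nat -> R) : Prop :=
  forall q p, in_L0 N V q p -> forall i, (i < N)%nat -> q i = 0 /\ p i = 0.

Definition lV_full (N : nat) (V : nat -> nat -> R) : Prop :=
  forall x : nat -> R, in_lV N V x.

Definition edge (N : nat) (adj : nat -> nat -> bool) (i j : nat) : Prop :=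
  (i < N)%nat /\ (j < N)%nat /\ adj i j = true.

Definition graph_symmetric (adj : nat -> nat -> bool) : Prop :=
  forall i j, adj i j = adj j i.

Definition all_loops (N : nat) (adj : nat -> nat -> bool) : Prop :=
  forall i, (i < N)%nat -> adj i i = true.

Definition graph_connected (N : nat) (adj : nat -> nat -> bool) : Prop :=
  forall i j, (i < N)%nat -> (j < N)%nat -> clos_refl_trans nat (edge N adj) i j.

(* The linear space S_Gamma of symmetric matrices supported on the edges of Gamma
   (its dimension is the number of edges, loops included). *)
Definition in_SGamma (N : nat) (adj : nat -> nat -> bool) (V : nat -> nat -> R) : Prop :=
  (forall i j, V i j = V j i) /\
  (forall i j, ~ edge N adj i j -> V i j = 0).

Definition pos_def (N : nat) (V : nat -> nat -> R) : Prop :=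
  forall x : nat -> R, (exists i, (i < N)%nat /\ x i <> 0) -> dot N x (matvec N V x) > 0.

Definition in_HGamma (N : nat) (adj : nat -> nat -> bool) (V : nat -> nat -> R) : Prop :=
  in_SGamma N adj V /\ pos_def N V.

(* closeness of matrices in the max-norm over entries (all norms are equivalent) *)
Definition mx_close (N : nat) (eps : R) (V W : nat -> nat -> R) : Prop :=
  forall i j, (i < N)%nat -> (j < N)%nat -> Rabs (V i j - W i j) < eps.

Definition rel_open (N : nat) (adj : nat -> nat -> bool) (A : (nat -> nat -> R) -> Prop) : Prop :=
  forall V, A V -> exists eps, eps > 0 /\
    forall W, in_HGamma N adj W -> mx_close N eps V W -> A W.

Definition dense_in_H (N : nat) (adj : nat -> nat -> bool) (A : (nat -> nat -> R) -> Prop) : Prop :=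
  forall V, in_HGamma N adj V -> forall eps, eps > 0 ->
    exists W, A W /\ mx_close N eps V W.

Inductive mpoly : Type :=
| PConst : R -> mpoly
| PVar : nat -> nat -> mpoly
| PAdd : mpoly -> mpoly -> mpoly
| PMul : mpoly -> mpoly -> mpoly.

Fixpoint peval (p : mpoly) (V : nat -> nat -> R) : R :=
  match p with
  | PConst c => c
  | PVar i j => V i j
  | PAdd p1 p2 => peval p1 V + peval p2 V
  | PMul p1 p2 => peval p1 V * peval p2 V
  end.

(* "The subset B of H_Gamma has dimension < dim H_Gamma", in the algebraic sense:
   B is contained in the zero locus of a polynomial function on the linear space
   S_Gamma (= R^{#edges}) which does not vanish identically on S_Gamma. *)
Definition lower_dim (N : nat) (adj : nat -> nat -> bool) (B : (nat -> nat -> R) -> Prop) : Prop :=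
  exists p : mpoly,
    (exists W, in_SGamma N adj W /\ peval p W <> 0) /\
    (forall V, B V -> peval p V = 0).

(* Main.v *)
(* The determinant of the Krylov matrix [e_1, V e_1, ..., V^(N-1) e_1] is a polynomial in
   the entries of V whose non-vanishing forces l_V = R^N; take H_Gamma^(+) to be the part of
   H_Gamma where it does not vanish.  This set is open, and its complement lies in the zero set
   of the polynomial, so everything follows once the polynomial is nonzero at a single W in
   H_Gamma: along the segment from any V to W (which stays in the convex set H_Gamma) the
   determinant is a nonzero polynomial in the parameter, hence nonzero arbitrarily close to V.

   For the witness, order the vertices by graph distance from vertex 1, let D be diagonal with
   increasing entries along this order and L the matrix of edges from one distance layer to the
   next.  The matrix D + L is triangular with distinct eigenvalues; the coordinates of a left
   eigenvector all share one sign, and following the layers back to vertex 1 shows that its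
   first coordinate is nonzero, which makes e_1 cyclic.  This persists for D + L + d L^T with d small, and that matrix is
   diagonally similar to the symmetric D + sqrt d (L + L^T), which is positive definite once D
   dominates. *)

Require Import Defs.
From Stdlib Require Import Reals Relations Lra Lia List Bool Classical.
From mathcomp Require all_boot all_algebra Rstruct.
Open Scope R_scope.

Lemma sumN_ext n f g : (forall k, (k < n)%nat -> f k = g k) -> sumN n f = sumN n g.
Proof.
  induction n; simpl; intros H; auto.
  rewrite IHn by (intros; apply H; lia). rewrite H by lia. reflexivity.
Qed.

Lemma sumN_add n f g : sumN n (fun k => f k + g k) = sumN n f + sumN n g.
Proof. induction n; simpl. lra. rewrite IHn; lra. Qed.

Lemma sumN_scal n c f : sumN n (fun k => c * f k) = c * sumN n f.
Proof. induction n; simpl. lra. rewrite IHn; lra. Qed.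

Lemma sumN_opp n f : sumN n (fun k => - f k) = - sumN n f.
Proof. induction n; simpl. lra. rewrite IHn; lra. Qed.

Lemma sumN_const n c : sumN n (fun _ => c) = INR n * c.
Proof. induction n; simpl sumN. simpl; lra. rewrite IHn, S_INR. lra. Qed.

Lemma sumN_swap n m (f : nat -> nat -> R) :
  sumN n (fun i => sumN m (fun j => f i j)) = sumN m (fun j => sumN n (fun i => f i j)).
Proof.
  induction n; simpl.
  - rewrite sumN_const. ring.
  - rewrite IHn, <- sumN_add. reflexivity.
Qed.

Lemma sumN_le n f g : (forall k, (k < n)%nat -> f k <= g k) -> sumN n f <= sumN n g.
Proof.
  induction n; simpl; intros H. lra.
  assert (sumN n f <= sumN n g) by (apply IHn; intros; apply H; lia).
  assert (f n <= g n) by (apply H; lia). lra.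
Qed.

Lemma sumN_ge0 n f : (forall k, (k < n)%nat -> 0 <= f k) -> 0 <= sumN n f.
Proof.
  intros H. replace 0 with (sumN n (fun _ => 0)) by (rewrite sumN_const; ring).
  apply sumN_le; auto.
Qed.

Lemma sumN_ge_term n f i : (forall k, (k < n)%nat -> 0 <= f k) -> (i < n)%nat -> f i <= sumN n f.
Proof.
  induction n; simpl; intros H Hi. lia.
  assert (0 <= sumN n f) by (apply sumN_ge0; intros; apply H; lia).
  destruct (Nat.eq_dec i n) as [->|Hne]. lra.
  assert (f i <= sumN n f) by (apply IHn; auto; try lia; intros; apply H; lia).
  assert (0 <= f n) by (apply H; lia). lra.
Qed.

Lemma sumN_sqr_eq0 n q : sumN n (fun i => q i * q i) = 0 -> forall i, (i < n)%nat -> q i = 0.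
Proof.
  intros H i Hi. apply Rsqr_0_uniq. unfold Rsqr.
  assert (q i * q i <= sumN n (fun i => q i * q i)).
  { apply (sumN_ge_term n (fun i => q i * q i)); auto. intros; nra. }
  nra.
Qed.

Fixpoint vars_below (N : nat) (p : mpoly) : Prop :=
  match p with
  | PConst _ => True
  | PVar i j => (i < N)%nat /\ (j < N)%nat
  | PAdd a b | PMul a b => vars_below N a /\ vars_below N b
  end.

Definition is_poly_fun (N : nat) (f : (nat -> nat -> R) -> R) : Prop :=
  exists p, vars_below N p /\ forall V, peval p V = f V.

Lemma is_poly_fun_const N c : is_poly_fun N (fun _ => c).
Proof. exists (PConst c); simpl; auto. Qed.

Lemma is_poly_fun_entry N i j : (i < N)%nat -> (j < N)%nat -> is_poly_fun N (fun V => V i j).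
Proof. intros; exists (PVar i j); simpl; auto. Qed.

Lemma is_poly_fun_add N f g : is_poly_fun N f -> is_poly_fun N g -> is_poly_fun N (fun V => f V + g V).
Proof.
  intros [p [Hp Ep]] [q [Hq Eq]]. exists (PAdd p q); simpl; split; auto.
  intros; now rewrite Ep, Eq.
Qed.

Lemma is_poly_fun_mul N f g : is_poly_fun N f -> is_poly_fun N g -> is_poly_fun N (fun V => f V * g V).
Proof.
  intros [p [Hp Ep]] [q [Hq Eq]]. exists (PMul p q); simpl; split; auto.
  intros; now rewrite Ep, Eq.
Qed.

Lemma is_poly_fun_ext N f g : is_poly_fun N f -> (forall V, f V = g V) -> is_poly_fun N g.
Proof. intros [p [Hp Ep]] H. exists p; split; auto. intros; now rewrite Ep. Qed.

Lemma is_poly_fun_sumN N n F : (forall k, (k < n)%nat -> is_poly_fun N (F k)) ->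
  is_poly_fun N (fun V => sumN n (fun k => F k V)).
Proof.
  induction n; simpl; intros H. apply is_poly_fun_const.
  apply is_poly_fun_add. apply IHn; intros; apply H; lia. apply H; lia.
Qed.

Lemma is_poly_fun_krylov N k i : (i < N)%nat -> is_poly_fun N (fun V => krylov N V k i).
Proof.
  revert i; induction k; intros i Hi; simpl.
  - apply is_poly_fun_const.
  - apply is_poly_fun_sumN. intros j Hj.
    apply is_poly_fun_mul; [apply is_poly_fun_entry | apply IHk]; auto.
Qed.

Lemma peval_ext p V W : (forall i j, V i j = W i j) -> peval p V = peval p W.
Proof. intros H; induction p; simpl; auto; congruence. Qed.

Lemma mx_close_le N d d' V W : d <= d' -> mx_close N d V W -> mx_close N d' V W.
Proof. intros Hd H i j Hi Hj. specialize (H i j Hi Hj). lra. Qed.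

Lemma Rmult_continuous a b eps : 0 < eps -> exists d, 0 < d /\
  forall a' b', Rabs (a' - a) < d -> Rabs (b' - b) < d -> Rabs (a' * b' - a * b) < eps.
Proof.
  intros He. set (A := Rabs a + Rabs b + 1).
  assert (HA : 0 < A) by (unfold A; pose proof (Rabs_pos a); pose proof (Rabs_pos b); lra).
  exists (Rmin 1 (eps / (2 * A))). split.
  { apply Rmin_glb_lt. lra. apply Rdiv_lt_0_compat; lra. }
  intros a' b' Ha Hb.
  pose proof (Rmin_l 1 (eps / (2 * A))). pose proof (Rmin_r 1 (eps / (2 * A))).
  set (d := Rmin 1 (eps / (2 * A))) in *.
  assert (Hb' : Rabs b' <= A).
  { replace b' with (b + (b' - b)) by ring. pose proof (Rabs_triang b (b' - b)).
    pose proof (Rabs_pos a). unfold A. lra. }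
  replace (a' * b' - a * b) with ((a' - a) * b' + a * (b' - b)) by ring.
  eapply Rle_lt_trans. apply Rabs_triang. rewrite !Rabs_mult.
  assert (T1 : Rabs (a' - a) * Rabs b' <= d * A).
  { apply Rmult_le_compat; try apply Rabs_pos; lra. }
  assert (T2 : Rabs a * Rabs (b' - b) < A * d).
  { assert (Rabs a < A) by (unfold A; pose proof (Rabs_pos b); lra).
    pose proof (Rabs_pos a); pose proof (Rabs_pos (b' - b)). nra. }
  assert (A * (eps / (2 * A)) = eps / 2) by (field; lra).
  assert (d * A <= eps / 2) by nra.
  lra.
Qed.

Lemma peval_continuous N p : vars_below N p -> forall V eps, 0 < eps -> exists d, 0 < d /\
  forall W, mx_close N d V W -> Rabs (peval p W - peval p V) < eps.
Proof.
  induction p as [c|i j|p1 IH1 p2 IH2|p1 IH1 p2 IH2]; simpl; intros Hb V eps He.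
  - exists 1; split; [lra|]. intros. rewrite Rminus_diag, Rabs_R0; lra.
  - exists eps; split; auto. intros W HW. rewrite Rabs_minus_sym. apply HW; tauto.
  - destruct Hb as [H1 H2].
    destruct (IH1 H1 V (eps / 2)) as [d1 [Hd1 E1]]; [lra|].
    destruct (IH2 H2 V (eps / 2)) as [d2 [Hd2 E2]]; [lra|].
    exists (Rmin d1 d2); split; [apply Rmin_glb_lt; auto|]. intros W HW.
    specialize (E1 W (mx_close_le _ _ _ _ _ (Rmin_l d1 d2) HW)).
    specialize (E2 W (mx_close_le _ _ _ _ _ (Rmin_r d1 d2) HW)).
    replace (peval p1 W + peval p2 W - (peval p1 V + peval p2 V)) with
      ((peval p1 W - peval p1 V) + (peval p2 W - peval p2 V)) by ring.
    eapply Rle_lt_trans. apply Rabs_triang. lra.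
  - destruct Hb as [H1 H2].
    destruct (Rmult_continuous (peval p1 V) (peval p2 V) eps He) as [d [Hd Hm]].
    destruct (IH1 H1 V d Hd) as [d1 [Hd1 E1]].
    destruct (IH2 H2 V d Hd) as [d2 [Hd2 E2]].
    exists (Rmin d1 d2); split; [apply Rmin_glb_lt; auto|]. intros W HW.
    apply Hm.
    + apply E1, (mx_close_le _ _ _ _ _ (Rmin_l d1 d2) HW).
    + apply E2, (mx_close_le _ _ _ _ _ (Rmin_r d1 d2) HW).
Qed.

Lemma is_poly_fun_neq0_near N f V : is_poly_fun N f -> f V <> 0 ->
  exists d, 0 < d /\ forall W, mx_close N d V W -> f W <> 0.
Proof.
  intros [p [Hp Ep]] HV.
  destruct (peval_continuous N p Hp V (Rabs (f V))) as [d [Hd Hc]].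
  { apply Rabs_pos_lt; auto. }
  exists d; split; auto. intros W HW E.
  specialize (Hc W HW). rewrite !Ep, E, Rminus_0_l, Rabs_Ropp in Hc. lra.
Qed.

Definition mx_interp (V W : nat -> nat -> R) (t : R) : nat -> nat -> R :=
  fun i j => V i j + t * (W i j - V i j).

Lemma sample_point_bounds eta k : 0 < eta -> 0 < eta / INR (k + 2) < eta.
Proof.
  intros He. assert (Hk : 1 < INR (k + 2)) by (rewrite plus_INR; simpl; pose proof (pos_INR k); lra).
  split. apply Rdiv_lt_0_compat; lra.
  apply (Rmult_lt_reg_r (INR (k + 2))); [lra|]. field_simplify; nra.
Qed.

Lemma sample_point_inj eta k l : 0 < eta -> eta / INR (k + 2) = eta / INR (l + 2) -> k = l.
Proof.
  intros He E. unfold Rdiv in E.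
  apply Rmult_eq_reg_l, Rinv_eq_reg, INR_eq in E; lia || lra.
Qed.

Module PolyKrylov.
Import all_boot all_algebra Rstruct GRing.Theory.

Lemma sumN_big n f : sumN n f = (\sum_(k < n) f k)%R.
Proof. elim: n => [|n IH] /=; first by rewrite big_ord0. by rewrite big_ord_recr /= IH. Qed.

Lemma is_poly_fun_big N (I : Type) (r : seq I) (P : pred I) F :
  (forall i, is_poly_fun N (F i)) -> is_poly_fun N (fun V => (\sum_(i <- r | P i) F i V)%R).
Proof.
  move=> H; elim: r => [|a r IH].
    by apply: is_poly_fun_ext (is_poly_fun_const N 0) _ => V; rewrite big_nil.
  case Pa: (P a); last by apply: is_poly_fun_ext IH _ => V; rewrite big_cons Pa.
  apply: is_poly_fun_ext (is_poly_fun_add _ _ _ (H a) IH) _ => V.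
  by rewrite big_cons Pa.
Qed.

Lemma is_poly_fun_bigprod N (I : Type) (r : seq I) (P : pred I) F :
  (forall i, is_poly_fun N (F i)) -> is_poly_fun N (fun V => (\prod_(i <- r | P i) F i V)%R).
Proof.
  move=> H; elim: r => [|a r IH].
    by apply: is_poly_fun_ext (is_poly_fun_const N 1) _ => V; rewrite big_nil.
  case Pa: (P a); last by apply: is_poly_fun_ext IH _ => V; rewrite big_cons Pa.
  apply: is_poly_fun_ext (is_poly_fun_mul _ _ _ (H a) IH) _ => V.
  by rewrite big_cons Pa.
Qed.

Lemma is_poly_fun_interp N f V W : is_poly_fun N f ->
  exists P : {poly R}, forall t, f (mx_interp V W t) = (P.[t])%R.
Proof.
  move=> [p [_ Ep]]; suff [P EP] : exists P : {poly R}, forall t, peval p (mx_interp V W t) = (P.[t])%R.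
    by exists P => t; rewrite -Ep.
  elim: p {Ep} => [c|i j|p1 [P1 E1] p2 [P2 E2]|p1 [P1 E1] p2 [P2 E2]] /=.
  - by exists (c%:P)%R => t; rewrite hornerC.
  - exists ((V i j)%:P + (W i j - V i j) *: 'X)%R => t.
    by rewrite hornerD hornerC hornerZ hornerX [(_ * t)%R]mulrC.
  - by exists (P1 + P2)%R => t; rewrite hornerD E1 E2.
  - by exists (P1 * P2)%R => t; rewrite hornerM E1 E2.
Qed.

(* A nonzero polynomial cannot vanish at the [size P] distinct points [eta / (k + 2)]. *)
Lemma poly_neq0_near (P : {poly R}) eta : (P != 0)%R -> 0 < eta ->
  exists t, 0 < t < eta /\ (P.[t])%R <> 0.
Proof.
  move=> HP He; apply: NNPP => Hn.
  pose rs := [seq eta / INR (k + 2) | k <- iota 0 (size P)].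
  have Hroot : all (root P) rs.
    apply/allP => y /mapP [k _ ->]; apply/eqP; apply: NNPP => Hy.
    by apply: Hn; exists (eta / INR (k + 2)); split; first exact: sample_point_bounds.
  have Huniq : uniq rs.
    by rewrite map_inj_uniq ?iota_uniq // => k l /(sample_point_inj eta k l He).
  by have := max_poly_roots HP Hroot Huniq; rewrite size_map size_iota ltnn.
Qed.

Lemma is_poly_fun_interp_neq0 N f V W eta : is_poly_fun N f -> f W <> 0 -> 0 < eta ->
  exists t, 0 < t < eta /\ f (mx_interp V W t) <> 0.
Proof.
  move=> Hf HW He; have [P EP] := is_poly_fun_interp N f V W Hf.
  have HP : (P != 0)%R.
    apply/eqP => P0; apply: HW; have [p [_ Ep]] := Hf.
    rewrite -Ep -(peval_ext p (mx_interp V W 1)) ?Ep ?EP ?P0 ?horner0 //.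
    by move=> i j; rewrite /mx_interp; ring.
  have [t [Ht Pt]] := poly_neq0_near P eta HP He.
  by exists t; rewrite EP.
Qed.

Definition krylov_mx (N : nat) (V : nat -> nat -> R) : 'M[R]_N :=
  \matrix_(i < N, j < N) krylov N V j i.

Definition krylov_det (N : nat) (V : nat -> nat -> R) : R := determinant (krylov_mx N V).

Lemma is_poly_fun_krylov_det N : is_poly_fun N (krylov_det N).
Proof.
  apply: is_poly_fun_big => s; apply: is_poly_fun_mul; first exact: is_poly_fun_const.
  apply: is_poly_fun_bigprod => i.
  have Hi : (i < N)%coq_nat by apply/ssrnat.ltP.
  apply: (is_poly_fun_ext N (fun V => krylov N V (perm.fun_of_perm.body s i) i)).
    exact: is_poly_fun_krylov.
  by move=> V; rewrite mxE.
Qed.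

Lemma krylov_det_lV_full N V : krylov_det N V <> 0 -> lV_full N V.
Proof.
  move=> Hd x.
  have U : krylov_mx N V \in unitmx by rewrite unitmxE unitfE; apply/eqP.
  pose c := (invmx (krylov_mx N V) *m \col_i x i)%R.
  have E : (krylov_mx N V *m c = \col_i x i)%R by rewrite /c mulKVmx.
  exists N, (fun k => if insub k is Some o then c o ord0 else 0) => i Hi.
  have := congr1 (fun A : 'M[R]_(N, 1) => A (Ordinal (introT ssrnat.ltP Hi)) ord0) E.
  rewrite !mxE /= => <-; rewrite sumN_big; apply: eq_bigr => k _.
  by rewrite valK !mxE mulrC.
Qed.

Lemma krylov_det_neq0 N V :
  (forall x : nat -> R, (forall j, (j < N)%coq_nat -> sumN N (fun u => x u * krylov N V j u) = 0) ->
     forall u, (u < N)%coq_nat -> x u = 0) ->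
  krylov_det N V <> 0.
Proof.
  move=> H /eqP /det0P [v vnz vK].
  pose x u := if insub u is Some o then v ord0 o else 0.
  have Hx : forall j, (j < N)%coq_nat -> sumN N (fun u => x u * krylov N V j u) = 0.
    move=> j /ssrnat.ltP Hj.
    have := congr1 (fun A : 'M[R]_(1, N) => A ord0 (Ordinal Hj)) vK.
    have -> : (0 : R) = 0%R by [].
    rewrite !mxE => <-; rewrite sumN_big; apply: eq_bigr => u _.
    by rewrite /x valK mxE.
  move/eqP: vnz; apply; apply/matrixP => a b; rewrite ord1 mxE.
  by have := H x Hx b (ssrnat.ltP (ltn_ord b)); rewrite /x valK.
Qed.

Lemma krylov_det_rescale N V V' (s : nat -> R) :
  (forall k i, (i < N)%coq_nat -> krylov N V k i = s i * krylov N V' k i) ->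
  (forall i, (i < N)%coq_nat -> s i <> 0) ->
  krylov_det N V' <> 0 -> krylov_det N V <> 0.
Proof.
  move=> H Hs Hd.
  have E : krylov_mx N V = (diag_mx (\row_(i < N) s i) *m krylov_mx N V')%R.
    rewrite mul_diag_mx; apply/matrixP => i j; rewrite !mxE.
    exact/H/ssrnat.ltP.
  rewrite /krylov_det E det_mulmx det_diag; apply/eqP.
  rewrite mulf_eq0 negb_or; apply/andP; split; last exact/eqP.
  by apply/prodf_neq0 => i _; rewrite mxE; apply/eqP/Hs/ssrnat.ltP.
Qed.

End PolyKrylov.

Import PolyKrylov.

Lemma matvec_interp N V W t x i :
  matvec N (mx_interp V W t) x i = (1 - t) * matvec N V x i + t * matvec N W x i.
Proof.
  unfold matvec, mx_interp. rewrite <- !sumN_scal, <- sumN_add.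
  apply sumN_ext; intros; ring.
Qed.

Lemma dot_interp N V W t x :
  dot N x (matvec N (mx_interp V W t) x) =
  (1 - t) * dot N x (matvec N V x) + t * dot N x (matvec N W x).
Proof.
  unfold dot. rewrite <- !sumN_scal, <- sumN_add.
  apply sumN_ext; intros. rewrite matvec_interp. ring.
Qed.

Lemma in_HGamma_interp N adj V W t : in_HGamma N adj V -> in_HGamma N adj W ->
  0 <= t <= 1 -> in_HGamma N adj (mx_interp V W t).
Proof.
  intros [[VS VE] VP] [[WS WE] WP] Ht. split; [split|].
  - intros i j. unfold mx_interp. rewrite VS, WS. reflexivity.
  - intros i j Hne. unfold mx_interp. rewrite VE, WE by auto. ring.
  - intros x Hx. rewrite dot_interp.
    specialize (VP x Hx). specialize (WP x Hx). nra.
Qed.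

Lemma mx_close_interp N V W eps : 0 < eps ->
  exists eta, 0 < eta /\ forall t, 0 <= t < eta -> mx_close N eps V (mx_interp V W t).
Proof.
  intros He.
  set (M := sumN N (fun i => sumN N (fun j => Rabs (W i j - V i j))) + 1).
  assert (HM : forall i j, (i < N)%nat -> (j < N)%nat -> Rabs (W i j - V i j) < M).
  { intros i j Hi Hj. unfold M.
    assert (Rabs (W i j - V i j) <= sumN N (fun j => Rabs (W i j - V i j))).
    { apply (sumN_ge_term N (fun j => Rabs (W i j - V i j))); auto. intros; apply Rabs_pos. }
    assert (sumN N (fun j => Rabs (W i j - V i j)) <=
            sumN N (fun i => sumN N (fun j => Rabs (W i j - V i j)))).
    { apply (sumN_ge_term N (fun i => sumN N (fun j => Rabs (W i j - V i j)))); auto.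
      intros; apply sumN_ge0; intros; apply Rabs_pos. }
    lra. }
  assert (HM0 : 0 < M).
  { unfold M. assert (0 <= sumN N (fun i => sumN N (fun j => Rabs (W i j - V i j)))).
    { apply sumN_ge0; intros; apply sumN_ge0; intros; apply Rabs_pos. }
    lra. }
  exists (eps / M). split; [apply Rdiv_lt_0_compat; lra|].
  intros t Ht i j Hi Hj. unfold mx_interp.
  replace (V i j - (V i j + t * (W i j - V i j))) with (- (t * (W i j - V i j))) by ring.
  rewrite Rabs_Ropp, Rabs_mult, (Rabs_pos_eq t) by lra.
  specialize (HM i j Hi Hj). pose proof (Rabs_pos (W i j - V i j)).
  assert (eps / M * M = eps) by (field; lra).
  nra.
Qed.

Definition diag_fun (N : nat) (d : nat -> R) (i j : nat) : R :=
  if (i <? N) && (i =? j) then d i else 0.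

Lemma diag_fun_sym N (d : nat -> R) i j : diag_fun N d i j = diag_fun N d j i.
Proof.
  unfold diag_fun. destruct (Nat.eqb_spec i j) as [<-|Hne]; [now rewrite Nat.eqb_refl|].
  destruct (Nat.eqb_spec j i); [lia|]. now rewrite !andb_false_r.
Qed.

Lemma sumN_delta n i g : (i < n)%nat ->
  sumN n (fun j => (if i =? j then 1 else 0) * g j) = g i.
Proof.
  induction n; simpl; intros Hi. lia.
  destruct (Nat.eqb_spec i n) as [->|Hne].
  - rewrite (sumN_ext _ _ (fun _ => 0)), sumN_const; [ring|].
    intros k Hk. destruct (Nat.eqb_spec n k); [lia|ring].
  - rewrite IHn by lia. ring.
Qed.

Lemma sumN_diag_fun_l N d x u : (u < N)%nat ->
  sumN N (fun v => x v * diag_fun N d v u) = x u * d u.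
Proof.
  intros Hu. rewrite <- (sumN_delta N u (fun v => x v * d u)) by auto.
  apply sumN_ext; intros v Hv. unfold diag_fun.
  destruct (Nat.ltb_spec v N); [|lia].
  destruct (Nat.eqb_spec v u), (Nat.eqb_spec u v); subst; simpl; try lia; ring.
Qed.

Lemma sumN_diag_fun_r N d x u : (u < N)%nat ->
  sumN N (fun v => diag_fun N d u v * x v) = d u * x u.
Proof.
  intros Hu. rewrite <- (sumN_delta N u (fun v => d u * x v)) by auto.
  apply sumN_ext; intros v Hv. unfold diag_fun.
  destruct (Nat.ltb_spec u N); [|lia].
  destruct (Nat.eqb_spec u v); simpl; ring.
Qed.

Lemma mul_ge_neg_sqr a y z : 0 <= a <= 2 -> - (y * y + z * z) <= a * y * z.
Proof.
  intros Ha.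
  (* y^2 + z^2 + a y z = ((2 + a) (y + z)^2 + (2 - a) (y - z)^2) / 4 *)
  assert (0 <= (2 + a) * ((y + z) * (y + z))) by (apply Rmult_le_pos; [lra | apply Rle_0_sqr]).
  assert (0 <= (2 - a) * ((y - z) * (y - z))) by (apply Rmult_le_pos; [lra | apply Rle_0_sqr]).
  nra.
Qed.

Lemma pos_def_diag_dominant N d C :
  (forall i, (i < N)%nat -> 2 * INR N < d i) ->
  (forall i j, 0 <= C i j <= 2) ->
  pos_def N (fun i j => diag_fun N d i j + C i j).
Proof.
  intros Hd HC x [i0 [Hi0 Hx0]]. unfold dot, matvec.
  set (S := sumN N (fun i => x i * x i)).
  assert (Hsplit : sumN N (fun i => x i * sumN N (fun j => (diag_fun N d i j + C i j) * x j)) =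
     sumN N (fun i => d i * (x i * x i)) + sumN N (fun i => sumN N (fun j => C i j * x i * x j))).
  { rewrite <- sumN_add. apply sumN_ext; intros i Hi.
    rewrite (sumN_ext _ _ (fun j => diag_fun N d i j * x j + C i j * x j)) by (intros; ring).
    rewrite sumN_add, sumN_diag_fun_r, Rmult_plus_distr_l, <- sumN_scal by auto.
    f_equal; [ring|]. apply sumN_ext; intros; ring. }
  assert (Hcross : - (2 * INR N * S) <= sumN N (fun i => sumN N (fun j => C i j * x i * x j))).
  { apply Rle_trans with (sumN N (fun i => sumN N (fun j => - (x i * x i + x j * x j)))).
    - rewrite (sumN_ext N _ (fun i => - (INR N * (x i * x i)) + - S)).
      + rewrite sumN_add, sumN_opp, sumN_scal, sumN_const. fold S. lra.
      + intros i Hi. rewrite sumN_opp, sumN_add, sumN_const. fold S. ring.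
    - apply sumN_le; intros i Hi; apply sumN_le; intros j Hj. apply mul_ge_neg_sqr, HC. }
  assert (Hdiag : 2 * INR N * S < sumN N (fun i => d i * (x i * x i))).
  { assert (E : sumN N (fun i => d i * (x i * x i)) - 2 * INR N * S =
                sumN N (fun i => (d i - 2 * INR N) * (x i * x i))).
    { unfold S. rewrite <- sumN_scal. unfold Rminus. rewrite <- sumN_opp, <- sumN_add.
      apply sumN_ext; intros; ring. }
    assert (0 < sumN N (fun i => (d i - 2 * INR N) * (x i * x i))).
    { apply Rlt_le_trans with ((d i0 - 2 * INR N) * (x i0 * x i0)).
      - specialize (Hd i0 Hi0). assert (0 < x i0 * x i0) by nra. nra.
      - apply (sumN_ge_term N (fun i => (d i - 2 * INR N) * (x i * x i))); auto.
        intros i Hi. specialize (Hd i Hi). nra. }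
    lra. }
  lra.
Qed.

Fixpoint reach (N : nat) (adj : nat -> nat -> bool) (k v : nat) : bool :=
  match k with
  | O => v =? 0
  | S k' => reach N adj k' v || existsb (fun u => adj u v && reach N adj k' u) (seq 0 N)
  end.

Lemma reach_mono N adj k k' v : (k <= k')%nat -> reach N adj k v = true -> reach N adj k' v = true.
Proof. induction 1; auto. intros Hr; simpl; now rewrite IHle. Qed.

Lemma reach_step N adj k u v : (u < N)%nat -> adj u v = true -> reach N adj k u = true ->
  reach N adj (S k) v = true.
Proof.
  intros Hu Ha Hr; simpl. apply orb_true_iff; right.
  apply existsb_exists. exists u; split. apply in_seq; lia. now rewrite Ha, Hr.
Qed.

Lemma reach_inv N adj k v : reach N adj (S k) v = true ->
  reach N adj k v = true \/ exists u, (u < N)%nat /\ adj u v = true /\ reach N adj k u = true.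
Proof.
  simpl; intros H. apply orb_true_iff in H; destruct H as [H|H]; auto.
  right. apply existsb_exists in H. destruct H as [u [Hu H]]. apply in_seq in Hu.
  apply andb_true_iff in H. exists u; split; [lia|tauto].
Qed.

Lemma reach_connected N adj : (1 <= N)%nat -> graph_connected N adj ->
  exists M, forall v, (v < N)%nat -> reach N adj M v = true.
Proof.
  intros HN Hc.
  assert (Hv : forall v, (v < N)%nat -> exists k, reach N adj k v = true).
  { intros v Hv. specialize (Hc 0%nat v ltac:(lia) Hv).
    apply clos_rt_rtn1 in Hc. clear Hv. induction Hc as [|y z [Hy [Hz Ha]] Hrt [k Hk]].
    - now exists 0%nat.
    - exists (S k). exact (reach_step N adj k y z Hy Ha Hk). }
  assert (H : forall n, (n <= N)%nat -> exists M, forall v, (v < n)%nat -> reach N adj M v = true).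
  { induction n; intros Hn. { exists 0%nat; intros; lia. }
    destruct (IHn ltac:(lia)) as [M HM]. destruct (Hv n ltac:(lia)) as [k Hk].
    exists (M + k)%nat. intros v Hvn. destruct (Nat.eq_dec v n) as [->|Hne].
    - eapply reach_mono; [|eauto]; lia.
    - eapply reach_mono; [|apply HM; lia]; lia. }
  apply (H N); lia.
Qed.

Fixpoint first_true (P : nat -> bool) (n : nat) : nat :=
  match n with
  | O => 0
  | S n' => if P 0%nat then 0 else S (first_true (fun i => P (S i)) n')
  end.

Lemma first_true_spec n : forall P k, (k <= n)%nat -> P k = true ->
  P (first_true P n) = true /\ forall k', P k' = true -> (first_true P n <= k')%nat.
Proof.
  induction n; intros P k Hk HP; simpl.
  - replace k with 0%nat in HP by lia. split; auto. intros; lia.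
  - destruct (P 0%nat) eqn:E. { split; auto; intros; lia. }
    destruct k as [|k]; [congruence|].
    destruct (IHn (fun i => P (S i)) k ltac:(lia) HP) as [H1 H2]. split; auto.
    intros [|k'] Hk'; [congruence|]. specialize (H2 k' Hk'). lia.
Qed.

Lemma exists_argmax N (P : nat -> Prop) (f : nat -> nat) :
  (exists u, (u < N)%nat /\ P u) ->
  exists r, (r < N)%nat /\ P r /\ forall u, (u < N)%nat -> P u -> (f u <= f r)%nat.
Proof.
  induction N as [|N IH]; intros [u [Hu Pu]]; [lia|].
  destruct (classic (exists u, (u < N)%nat /\ P u)) as [Ex|Nx].
  - destruct (IH Ex) as [r [Hr [Pr Hm]]].
    destruct (classic (P N /\ (f r < f N)%nat)) as [[PN Hlt]|HN].
    + exists N; repeat split; auto. intros w Hw Pw.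
      destruct (Nat.eq_dec w N) as [->|]; auto. specialize (Hm w ltac:(lia) Pw). lia.
    + exists r; repeat split; auto. intros w Hw Pw.
      destruct (Nat.eq_dec w N) as [->|]; [|apply Hm; auto; lia].
      destruct (Nat.le_gt_cases (f N) (f r)); tauto.
  - exists N; repeat split.
    + lia.
    + destruct (Nat.eq_dec u N) as [<-|]; auto. exfalso; apply Nx; exists u; split; auto; lia.
    + intros w Hw Pw. destruct (Nat.eq_dec w N) as [->|]; auto.
      exfalso; apply Nx; exists w; split; auto; lia.
Qed.

Section Witness.
Variables (N : nat) (adj : nat -> nat -> bool) (M : nat).
Hypothesis N_pos : (1 <= N)%nat.
Hypothesis adj_sym : graph_symmetric adj.
Hypothesis adj_loops : all_loops N adj.
Hypothesis reach_all : forall v, (v < N)%nat -> reach N adj M v = true.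

Definition dist (v : nat) : nat := first_true (fun k => reach N adj k v) M.

(* Lexicographic order on (distance from vertex [0], index). *)
Definition key (v : nat) : nat := (N * dist v + v)%nat.

Definition diag_entry (v : nat) : R := INR (2 * N + 1) + INR (key v).

Definition layer_mx (i j : nat) : R :=
  if (i <? N) && (j <? N) && adj j i && (dist i =? S (dist j)) then 1 else 0.

Definition B_mx (d : R) (i j : nat) : R :=
  diag_fun N diag_entry i j + layer_mx i j + d * layer_mx j i.

Definition W_mx (e : R) (i j : nat) : R :=
  diag_fun N diag_entry i j + e * (layer_mx i j + layer_mx j i).

Lemma dist_spec v : (v < N)%nat -> reach N adj (dist v) v = true /\
  forall k, reach N adj k v = true -> (dist v <= k)%nat.
Proof. intros Hv. exact (first_true_spec M (fun k => reach N adj k v) M (le_n M) (reach_all v Hv)). Qed.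

Lemma dist_0 : dist 0 = 0%nat.
Proof. destruct (dist_spec 0 ltac:(lia)) as [_ H]. specialize (H 0%nat eq_refl). lia. Qed.

Lemma dist_eq0 v : (v < N)%nat -> dist v = 0%nat -> v = 0%nat.
Proof.
  intros Hv H. destruct (dist_spec v Hv) as [H1 _]. rewrite H in H1. now apply Nat.eqb_eq in H1.
Qed.

Lemma dist_parent v : (v < N)%nat -> v <> 0%nat ->
  exists u, (u < N)%nat /\ adj u v = true /\ dist v = S (dist u).
Proof.
  intros Hv Hnz. destruct (dist_spec v Hv) as [H1 H2].
  destruct (dist v) as [|k] eqn:E; [apply dist_eq0 in E; lia|].
  destruct (reach_inv N adj k v H1) as [H|[u [Hu [Ha Hr]]]].
  - specialize (H2 k H). lia.
  - exists u; repeat split; auto.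
    destruct (dist_spec u Hu) as [U1 U2]. specialize (U2 k Hr).
    specialize (H2 _ (reach_step N adj (dist u) u v Hu Ha U1)). lia.
Qed.

Lemma key_inj u v : (u < N)%nat -> (v < N)%nat -> key u = key v -> u = v.
Proof.
  unfold key; intros Hu Hv H.
  destruct (Nat.lt_trichotomy (dist u) (dist v)) as [C|[C|C]].
  - assert (N * dist u + N <= N * dist v)%nat by nia. lia.
  - rewrite C in H; lia.
  - assert (N * dist v + N <= N * dist u)%nat by nia. lia.
Qed.

Lemma key_lt u v : (u < N)%nat -> (dist u < dist v)%nat -> (key u < key v)%nat.
Proof. unfold key; intros Hu H. assert (N * dist u + N <= N * dist v)%nat by nia. lia. Qed.

Lemma diag_entry_lt u v : (key u < key v)%nat -> diag_entry u < diag_entry v.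
Proof. unfold diag_entry; intros H. apply lt_INR in H. lra. Qed.

Lemma layer_mx_cases i j : layer_mx i j = 0 \/
  (layer_mx i j = 1 /\ (i < N)%nat /\ (j < N)%nat /\ adj j i = true /\ dist i = S (dist j)).
Proof.
  unfold layer_mx. destruct (Nat.ltb_spec i N), (Nat.ltb_spec j N), (adj j i) eqn:E,
    (Nat.eqb_spec (dist i) (S (dist j))); simpl; auto; right; repeat split; auto.
Qed.

Lemma layer_mx_bounds i j : 0 <= layer_mx i j <= 1.
Proof. destruct (layer_mx_cases i j) as [H|[H _]]; rewrite H; lra. Qed.

Lemma sumN_left_B0 x u : (u < N)%nat ->
  sumN N (fun v => x v * B_mx 0 v u) = x u * diag_entry u + sumN N (fun v => x v * layer_mx v u).
Proof.
  intros Hu. rewrite (sumN_ext _ _ (fun v => x v * diag_fun N diag_entry v u + x v * layer_mx v u)).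
  - rewrite sumN_add, sumN_diag_fun_l; auto.
  - intros; unfold B_mx; ring.
Qed.

(* [x] is a left eigenvector of [B_mx 0] for the eigenvalue [diag_entry r], where
   [r] is the last vertex of the support of [x]. *)
Section LeftEigenvector.
Variables (x : nat -> R) (r : nat).
Hypothesis r_lt : (r < N)%nat.
Hypothesis x_r : x r <> 0.
Hypothesis r_max : forall u, (u < N)%nat -> x u <> 0 -> (key u <= key r)%nat.
Hypothesis x_eigen : forall u, (u < N)%nat ->
  sumN N (fun v => x v * layer_mx v u) = x u * (diag_entry r - diag_entry u).

Lemma eigen_eq_scaled u : (u < N)%nat ->
  sumN N (fun v => x v * x r * layer_mx v u) = x u * x r * (diag_entry r - diag_entry u).
Proof.
  intros Hu. rewrite (sumN_ext _ _ (fun v => x r * (x v * layer_mx v u))) by (intros; ring).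
  rewrite sumN_scal, x_eigen by auto. ring.
Qed.

(* Going down the key order, [x u] is a positive combination of the [x v] with larger key. *)
Lemma eigen_sign_agree u : (u < N)%nat -> 0 <= x u * x r.
Proof.
  remember (key r - key u)%nat as t eqn:Ht. assert (Hle : (key r - key u <= t)%nat) by lia.
  clear Ht. revert u Hle. induction t; intros u Hle Hu;
    (destruct (Nat.lt_trichotomy (key u) (key r)) as [C|[C|C]];
     [ | apply key_inj in C; auto; subst; nra
       | destruct (Req_dec (x u) 0) as [E|E]; [rewrite E; lra | specialize (r_max u Hu E); lia]]).
  - lia.
  - assert (S0 : 0 <= sumN N (fun v => x v * x r * layer_mx v u)).
    { apply sumN_ge0. intros v Hv. destruct (layer_mx_cases v u) as [L|[L [_ [_ [_ Hd]]]]].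
      - rewrite L; lra.
      - rewrite L, Rmult_1_r. apply IHt; auto.
        assert (key u < key v)%nat by (apply key_lt; auto; lia). lia. }
    rewrite eigen_eq_scaled in S0 by auto.
    assert (diag_entry u < diag_entry r) by (apply diag_entry_lt; auto).
    destruct (Rle_lt_dec 0 (x u * x r)); auto. nra.
Qed.

(* Walking from [r] to [0] along decreasing distance, the sign of [x] never gets lost. *)
Lemma eigen_coord0_neq0 : x 0%nat <> 0.
Proof.
  assert (Hchain : forall n w, (w < N)%nat -> dist w = n -> (key w <= key r)%nat ->
     0 < x w * x r -> 0 < x 0%nat * x r).
  { induction n; intros w Hw Hd Hk Hp.
    - apply dist_eq0 in Hd; subst; auto.
    - assert (Hw0 : w <> 0%nat) by (intros ->; rewrite dist_0 in Hd; lia).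
      destruct (dist_parent w Hw Hw0) as [u [Hu [Ha Hdu]]].
      assert (Lwu : layer_mx w u = 1).
      { unfold layer_mx. destruct (Nat.ltb_spec w N), (Nat.ltb_spec u N); try lia.
        rewrite Ha, Hdu, Nat.eqb_refl. reflexivity. }
      assert (Kuw : (key u < key w)%nat) by (apply key_lt; auto; lia).
      assert (T : x w * x r * layer_mx w u <= sumN N (fun v => x v * x r * layer_mx v u)).
      { apply (sumN_ge_term N (fun v => x v * x r * layer_mx v u)); auto.
        intros v Hv. pose proof (layer_mx_bounds v u). pose proof (eigen_sign_agree v Hv). nra. }
      rewrite eigen_eq_scaled, Lwu in T by auto.
      assert (diag_entry u < diag_entry r) by (apply diag_entry_lt; lia).
      apply (IHn u); auto; try lia. nra. }
  assert (P : 0 < x 0%nat * x r) by (apply (Hchain (dist r) r); auto; nra).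
  intros E; rewrite E in P; lra.
Qed.

End LeftEigenvector.

Fixpoint count_key_below (n k : nat) : nat :=
  match n with
  | O => O
  | S m => (count_key_below m k + (if key m <? k then 1 else 0))%nat
  end.

Lemma count_key_below_le n k : (count_key_below n k <= n)%nat.
Proof. induction n; simpl; [lia|]. destruct (key n <? k); lia. Qed.

Lemma count_key_below_mono n k1 k2 : (k1 <= k2)%nat ->
  (count_key_below n k1 <= count_key_below n k2)%nat.
Proof.
  intros Hk; induction n; simpl; [lia|].
  destruct (Nat.ltb_spec (key n) k1), (Nat.ltb_spec (key n) k2); lia.
Qed.

Lemma count_key_below_self n u : (u < n)%nat -> (count_key_below n (key u) < n)%nat.
Proof.
  induction n; intros Hu; simpl; [lia|].
  destruct (Nat.eq_dec u n) as [->|].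
  - rewrite Nat.ltb_irrefl. pose proof (count_key_below_le n (key n)). lia.
  - specialize (IHn ltac:(lia)). destruct (key n <? key u); lia.
Qed.

Lemma count_key_below_lt n w k1 k2 : (w < n)%nat -> (k1 <= key w)%nat -> (key w < k2)%nat ->
  (count_key_below n k1 < count_key_below n k2)%nat.
Proof.
  induction n; intros Hw H1 H2; simpl; [lia|].
  destruct (Nat.eq_dec w n) as [->|].
  - pose proof (count_key_below_mono n k1 k2 ltac:(lia)).
    destruct (Nat.ltb_spec (key n) k1), (Nat.ltb_spec (key n) k2); lia.
  - specialize (IHn ltac:(lia) H1 H2).
    destruct (Nat.ltb_spec (key n) k1), (Nat.ltb_spec (key n) k2); lia.
Qed.

Definition annihilates (n : nat) (x : nat -> R) : Prop :=
  forall j, (j < n)%nat -> sumN N (fun u => x u * krylov N (B_mx 0) j u) = 0.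

Lemma annihilates_shift n x lambda : annihilates (S n) x ->
  annihilates n (fun u => sumN N (fun v => x v * B_mx 0 v u) - lambda * x u).
Proof.
  intros Hx j Hj.
  rewrite (sumN_ext _ _ (fun u => sumN N (fun v => x v * B_mx 0 v u * krylov N (B_mx 0) j u)
             + - (lambda * (x u * krylov N (B_mx 0) j u)))).
  - rewrite sumN_add, sumN_opp, sumN_scal, sumN_swap, (Hx j ltac:(lia)).
    rewrite (sumN_ext _ _ (fun v => x v * krylov N (B_mx 0) (S j) v)).
    + rewrite (Hx (S j) ltac:(lia)). ring.
    + intros v Hv. simpl. unfold matvec. rewrite <- sumN_scal. apply sumN_ext; intros; ring.
  - intros u Hu. rewrite Rmult_minus_distr_r, (Rmult_comm _ (krylov _ _ _ _)), <- sumN_scal.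
    unfold Rminus. f_equal; [apply sumN_ext; intros; ring | ring].
Qed.

Lemma shift_vanishes_above x r u : (u < N)%nat ->
  (forall v, (v < N)%nat -> x v <> 0 -> (key v <= key r)%nat) -> (key r <= key u)%nat ->
  sumN N (fun v => x v * B_mx 0 v u) - diag_entry r * x u = 0.
Proof.
  intros Hu Hmax Hk. rewrite sumN_left_B0 by auto.
  assert (Hzero : forall v, (v < N)%nat -> (key r < key v)%nat -> x v = 0).
  { intros v Hv Hlt. destruct (Req_dec (x v) 0); auto. specialize (Hmax v Hv H). lia. }
  rewrite (sumN_ext _ _ (fun _ => 0)), sumN_const.
  - destruct (Nat.eq_dec (key u) (key r)) as [E|].
    + unfold diag_entry. rewrite E. ring.
    + rewrite (Hzero u) by (auto; lia). ring.
  - intros v Hv. destruct (layer_mx_cases v u) as [L|[L [_ [_ [_ Hd]]]]]; rewrite L; [ring|].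
    rewrite (Hzero v Hv); [ring|]. assert (key u < key v)%nat by (apply key_lt; auto; lia). lia.
Qed.

(* Induction on [n]: the shifted vector still annihilates [n - 1] Krylov vectors and has
   one vertex less in its support, so it vanishes; then [x] is a left eigenvector,
   whose first coordinate [x . e_1] cannot vanish. *)
Lemma annihilates_zero n x : annihilates n x ->
  (forall u, (u < N)%nat -> (n <= count_key_below N (key u))%nat -> x u = 0) ->
  forall u, (u < N)%nat -> x u = 0.
Proof.
  revert x; induction n as [|n IH]; intros x Hann Hsupp; [intros u Hu; apply Hsupp; auto; lia|].
  apply NNPP; intros Hx.
  assert (Ex : exists u, (u < N)%nat /\ x u <> 0).
  { apply NNPP; intros Hn; apply Hx; intros u Hu.
    destruct (Req_dec (x u) 0); auto. exfalso; eauto. }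
  destruct (exists_argmax N (fun u => x u <> 0) key Ex) as [r [Hr [Hxr Hmax]]].
  assert (Cr : (count_key_below N (key r) <= n)%nat).
  { destruct (Nat.le_gt_cases (S n) (count_key_below N (key r))); [|lia].
    exfalso; apply Hxr; auto. }
  assert (Hshift : forall u, (u < N)%nat ->
            sumN N (fun v => x v * B_mx 0 v u) - diag_entry r * x u = 0).
  { apply (IH _ (annihilates_shift n x (diag_entry r) Hann)).
    intros u Hu Hc. apply shift_vanishes_above; auto.
    destruct (Nat.le_gt_cases (key r) (key u)); auto.
    pose proof (count_key_below_lt N u (key u) (key r) Hu (le_n _) H). lia. }
  apply (eigen_coord0_neq0 x r Hr Hxr Hmax).
  - intros u Hu. specialize (Hshift u Hu). rewrite sumN_left_B0 in Hshift by auto. lra.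
  - specialize (Hann 0%nat ltac:(lia)). simpl in Hann. unfold e1 in Hann.
    rewrite <- Hann, <- (sumN_delta N 0 x) by lia.
    apply sumN_ext; intros u Hu. destruct (Nat.eqb_spec u 0), (Nat.eqb_spec 0 u); lia || ring.
Qed.

Lemma krylov_det_B0 : krylov_det N (B_mx 0) <> 0.
Proof.
  apply krylov_det_neq0. intros x Hx. apply (annihilates_zero N x Hx).
  intros u Hu Hc. pose proof (count_key_below_self N u Hu). lia.
Qed.

Lemma krylov_det_B_small : exists d, 0 < d <= 1 /\ krylov_det N (B_mx d) <> 0.
Proof.
  destruct (is_poly_fun_neq0_near N _ (B_mx 0) (is_poly_fun_krylov_det N) krylov_det_B0)
    as [d [Hd Hnear]].
  set (m := Rmin (d / 2) 1).
  assert (Hm : 0 < m <= d / 2 /\ m <= 1).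
  { unfold m. pose proof (Rmin_l (d / 2) 1). pose proof (Rmin_r (d / 2) 1).
    split; [split; [apply Rmin_glb_lt|]|]; lra. }
  exists m. split; [lra|].
  apply Hnear. intros i j Hi Hj. unfold B_mx.
  replace (_ - _) with (- (m * layer_mx j i)) by ring.
  pose proof (layer_mx_bounds j i). rewrite Rabs_Ropp, Rabs_pos_eq by nra. nra.
Qed.

Lemma W_mx_rescale e i j : (i < N)%nat -> (j < N)%nat ->
  W_mx e i j * e ^ dist j = e ^ dist i * B_mx (e * e) i j.
Proof.
  intros Hi Hj. unfold W_mx, B_mx.
  assert (D : diag_fun N diag_entry i j * e ^ dist j = e ^ dist i * diag_fun N diag_entry i j).
  { unfold diag_fun. destruct (Nat.eqb_spec i j) as [->|]; [ring|]. rewrite andb_false_r. ring. }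
  assert (L1 : e * layer_mx i j * e ^ dist j = e ^ dist i * layer_mx i j).
  { destruct (layer_mx_cases i j) as [L|[L [_ [_ [_ Hd]]]]]; rewrite L; [ring|].
    rewrite Hd; simpl; ring. }
  assert (L2 : e * layer_mx j i * e ^ dist j = e ^ dist i * (e * e * layer_mx j i)).
  { destruct (layer_mx_cases j i) as [L|[L [_ [_ [_ Hd]]]]]; rewrite L; [ring|].
    rewrite Hd; simpl; ring. }
  lra.
Qed.

Lemma krylov_W_mx e k i : (i < N)%nat ->
  krylov N (W_mx e) k i = e ^ dist i * krylov N (B_mx (e * e)) k i.
Proof.
  revert i; induction k; intros i Hi; simpl.
  - unfold e1. destruct (Nat.eqb_spec i 0) as [->|]; [rewrite dist_0; simpl|]; ring.
  - unfold matvec. rewrite <- sumN_scal. apply sumN_ext. intros j Hj.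
    rewrite IHk, <- Rmult_assoc, W_mx_rescale by auto. ring.
Qed.

Lemma W_mx_SGamma e : in_SGamma N adj (W_mx e).
Proof.
  split.
  - intros i j. unfold W_mx. rewrite diag_fun_sym. ring.
  - intros i j Hne. unfold W_mx.
    assert (D : diag_fun N diag_entry i j = 0).
    { unfold diag_fun. destruct (Nat.ltb_spec i N), (Nat.eqb_spec i j) as [->|]; simpl; auto.
      exfalso. apply Hne. repeat split; auto. }
    assert (L1 : layer_mx i j = 0).
    { destruct (layer_mx_cases i j) as [L|[L [Hi [Hj [Ha _]]]]]; auto. exfalso; apply Hne.
      repeat split; auto. rewrite adj_sym; auto. }
    assert (L2 : layer_mx j i = 0).
    { destruct (layer_mx_cases j i) as [L|[L [Hi [Hj [Ha _]]]]]; auto. exfalso; apply Hne.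
      repeat split; auto. }
    rewrite D, L1, L2. ring.
Qed.

Lemma W_mx_pos_def e : 0 <= e <= 1 -> pos_def N (W_mx e).
Proof.
  intros He. apply pos_def_diag_dominant.
  - intros i Hi. unfold diag_entry. rewrite plus_INR, mult_INR, INR_1.
    replace (INR 2) with 2 by (simpl; lra). pose proof (pos_INR (key i)). lra.
  - intros i j. pose proof (layer_mx_bounds i j). pose proof (layer_mx_bounds j i). nra.
Qed.

Lemma krylov_det_witness_W : exists W, in_HGamma N adj W /\ krylov_det N W <> 0.
Proof.
  destruct krylov_det_B_small as [d [Hd HB]].
  assert (He : 0 < sqrt d <= 1).
  { split; [apply sqrt_lt_R0; lra|]. rewrite <- sqrt_1. apply sqrt_le_1_alt; lra. }
  exists (W_mx (sqrt d)). split; [split; [apply W_mx_SGamma | apply W_mx_pos_def; lra]|].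
  apply (krylov_det_rescale N _ (B_mx d) (fun i => sqrt d ^ dist i)).
  - intros k i Hi. rewrite krylov_W_mx, sqrt_sqrt by (auto; lra). reflexivity.
  - intros i Hi. apply pow_nonzero. lra.
  - exact HB.
Qed.

End Witness.

Lemma krylov_det_witness N adj : (1 <= N)%nat -> graph_symmetric adj -> all_loops N adj ->
  graph_connected N adj -> exists W, in_HGamma N adj W /\ krylov_det N W <> 0.
Proof.
  intros HN Hsym Hloops Hconn. destruct (reach_connected N adj HN Hconn) as [M HM].
  exact (krylov_det_witness_W N adj M HN Hsym Hloops HM).
Qed.

Definition HGamma_plus (N : nat) (adj : nat -> nat -> bool) (V : nat -> nat -> R) : Prop :=
  in_HGamma N adj V /\ krylov_det N V <> 0.

Lemma HGamma_plus_open N adj : rel_open N adj (HGamma_plus N adj).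
Proof.
  intros V [HV Hdet].
  destruct (is_poly_fun_neq0_near N _ V (is_poly_fun_krylov_det N) Hdet) as [d [Hd Hnear]].
  exists d; split; auto. intros W HW Hclose. split; auto.
Qed.

Lemma HGamma_plus_dense N adj W : in_HGamma N adj W -> krylov_det N W <> 0 ->
  dense_in_H N adj (HGamma_plus N adj).
Proof.
  intros HW Hdet V HV eps Heps.
  destruct (mx_close_interp N V W eps Heps) as [eta [Heta Hclose]].
  destruct (is_poly_fun_interp_neq0 N _ V W (Rmin eta 1) (is_poly_fun_krylov_det N) Hdet)
    as [t [Ht Hdet_t]].
  { apply Rmin_glb_lt; lra. }
  pose proof (Rmin_l eta 1). pose proof (Rmin_r eta 1).
  exists (mx_interp V W t). split; [split|].
  - apply in_HGamma_interp; auto; lra.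
  - exact Hdet_t.
  - apply Hclose; lra.
Qed.

Lemma HGamma_plus_compl_lower_dim N adj W : in_HGamma N adj W -> krylov_det N W <> 0 ->
  lower_dim N adj (fun V => in_HGamma N adj V /\ ~ HGamma_plus N adj V).
Proof.
  intros [HW _] Hdet. destruct (is_poly_fun_krylov_det N) as [p [_ Ep]].
  exists p. split.
  - exists W. rewrite Ep. auto.
  - intros V [HV Hn]. rewrite Ep. apply NNPP. intros Hd. apply Hn. split; auto.
Qed.

Lemma lV_full_L0_trivial N V : lV_full N V -> L0_trivial N V.
Proof.
  intros Hf q p H i Hi.
  assert (Hq := H q (fun _ => 0) (conj (Hf q) (Hf (fun _ => 0)))).
  assert (Hp := H (fun _ => 0) p (conj (Hf (fun _ => 0)) (Hf p))).
  unfold dot in Hq, Hp.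
  rewrite (sumN_ext _ (fun i => p i * 0) (fun _ => 0)), sumN_const in Hq by (intros; ring).
  rewrite (sumN_ext _ (fun i => q i * 0) (fun _ => 0)), sumN_const in Hp by (intros; ring).
  split; [apply (sumN_sqr_eq0 N q) | apply (sumN_sqr_eq0 N p)]; auto; lra.
Qed.

Theorem mainTheorem19 (N : nat) (adj : nat -> nat -> bool) :
  (1 <= N)%nat ->
  graph_symmetric adj ->
  all_loops N adj ->
  graph_connected N adj ->
  exists Hplus : (nat -> nat -> R) -> Prop,
    (forall V, Hplus V -> in_HGamma N adj V) /\
    rel_open N adj Hplus /\
    dense_in_H N adj Hplus /\
    lower_dim N adj (fun V => in_HGamma N adj V /\ ~ Hplus V) /\
    (forall V, Hplus V -> L0_trivial N V /\ lV_full N V).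
Proof.
  intros HN Hsym Hloops Hconn.
  destruct (krylov_det_witness N adj HN Hsym Hloops Hconn) as [W [HW Hdet]].
  exists (HGamma_plus N adj). split; [|split; [|split; [|split]]].
  - intros V [HV _]; exact HV.
  - apply HGamma_plus_open.
  - exact (HGamma_plus_dense N adj W HW Hdet).
  - exact (HGamma_plus_compl_lower_dim N adj W HW Hdet).
  - intros V [_ Hd]. pose proof (krylov_det_lV_full N V Hd).
    split; auto using lV_full_L0_trivial.
Qed.
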